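(* Let $p$ be an odd prime that is a primitive root modulo $4$, let $q=p^2$, let $g$ be a primitive element of $\mathbb{F}_q$, and let $\xi=g^{\frac{q-1}{4}}$. For any $a\in\mathbb{F}_q$, written as $a=a_1\xi+a_2\xi^2$ with $a_1,a_2\in\mathbb{F}_p$, we have $$S_4(a)=\zeta_p^{2a_1}+\zeta_p^{-2a_1}+\zeta_p^{2a_2}+\zeta_p^{-2a_2}.$$
   Context: $\zeta_p=e^{2\pi i/p}$; for $u\in\mathbb{F}_p$, $\zeta_p^{u}$ is defined via any integer representative of $u$. ${\rm Tr}$ is the absolute trace $\mathbb{F}_q\to\mathbb{F}_p$, and $\chi(x)=e^{2\pi i{\rm Tr}(x)/p}$ is the canonical additive character of $\mathbb{F}_q$. For $a\in\mathbb{F}_q$, $S_4(a):=\sum_{i=0}^{3}\chi(a\xi^i)$. A primitive element of $\mathbb{F}_q$ is a generator of $\mathbb{F}_q^*$. The set $\{\xi,\xi^2\}$ is a basis of $\mathbb{F}_q$ over $\mathbb{F}_p$, so $a_1,a_2$ are uniquely determined. *)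

(* Defs.v *)
From HB Require Import structures.
From mathcomp Require Import all_boot all_order all_algebra.
From mathcomp Require Import all_fingroup all_solvable all_field.
From mathcomp Require Import complex.
From mathcomp Require Import reals trigo.
Set Implicit Arguments.
Unset Strict Implicit.
Unset Printing Implicit Defensive.
Import Order.TTheory GRing.Theory Num.Theory.
Local Open Scope ring_scope.
Local Open Scope complex_scope.

(* Only meaningful for n > 1, since 'Z_0 and 'Z_1 are both Z/2. *)
Definition primitive_root_mod (n a : nat) : Prop :=
  exists2 u : {unit 'Z_n}, val u = a%:R & generator (units_Zp n) u.

Section Characters.
Variables (R : realType) (F : finFieldType) (p : nat).
Hypothesis charFp : p \in [pchar F].

(* pPrimeCharType charFp is F itself, seen as an extension of 'F_p;
   1%AS is its prime subfield. *)
Definition galois_trace (x : F) : F :=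
  galTrace 1%AS {: pPrimeCharType charFp}%AS x.

(* galois_trace takes its values in the prime subfield of F, so the default
   value 0 is never used: see absolute_traceP. *)
Definition absolute_trace (x : F) : 'F_p :=
  odflt 0 [pick u : 'F_p | (u : nat)%:R == galois_trace x].

Lemma absolute_traceP x : (absolute_trace x : nat)%:R = galois_trace x.
Proof.
rewrite /absolute_trace; case: pickP => [u /eqP // | no_u].
have := @mem_galTrace _ (pPrimeCharType charFp) 1%AS {:_}%AS x
  (finField_galois (sub1v _)) (memvf _).
case/vlineP => u Du; have := no_u u.
by rewrite /galois_trace Du; case/eqP; apply/esym; apply: mulr1.
Qed.

Definition expi (t : R) : R[i] := cos t +i* sin t.

Definition additive_char (x : F) : R[i] :=
  expi (2 * pi * (absolute_trace x : nat)%:R / p%:R).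

Definition zeta (u : 'F_p) : R[i] := expi (2 * pi / p%:R) ^+ (u : nat).

Definition char_sum4 (xi a : F) : R[i] := \sum_(i < 4) additive_char (a * xi ^+ i).

End Characters.

Arguments zeta R {p} u.
Arguments char_sum4 R {F p} charFp xi a.

(* Main.v *)
Require Import Defs.
From HB Require Import structures.
From mathcomp Require Import all_boot all_order all_algebra.
From mathcomp Require Import all_fingroup cyclic finfield.
From mathcomp Require Import falgebra fieldext galois.
From mathcomp Require Import complex.
From mathcomp Require Import reals trigo.
Import Order.TTheory GRing.Theory Num.Theory.
Local Open Scope ring_scope.

(** Since p generates the units modulo 4, p is 3 modulo 4. The element xi has
order 4, so xi ^+ 2 = -1 and the Frobenius map sends xi to
xi ^+ p = xi ^+ 3 = - xi. The absolute trace is invariant under Frobenius, so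
Tr xi = - Tr xi, which vanishes as p is odd; and Tr 1 = 2, the degree of F over
its prime field. Thus, in the basis (1, xi), the trace is twice the
coordinate on 1. Multiplication by xi rotates the coordinates: the elements
a, a xi, a xi^2, a xi^3 are
  - a2 + a1 xi,  - a1 - a2 xi,  a2 - a1 xi,  a1 + a2 xi,
with traces -2 a2, -2 a1, 2 a2, 2 a1. The additive character at x being
zeta (Tr x), the four terms of the sum are those of the formula.

The Galois-theoretic input is thus reduced to three properties of the trace:
additivity, invariance (absolute_trace_Frobenius), and its value at 1
(absolute_trace1); no explicit sum of conjugates is computed. *)

Lemma primitive_root_mod4 p : primitive_root_mod 4 p -> (p %% 4 = 3)%N.
Proof.
case=> u Du gen_u.
have : (p%:R : 'Z_4) \is a GRing.unit by rewrite -Du (valP u).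
rewrite unitZpE // -coprime_modr.
have : (p %% 4 != 1)%N.
  apply/eqP=> p1; have u1 : u = 1%g.
    apply/val_inj; rewrite Du; apply/val_inj.
    by rewrite /= (val_Zp_nat (isT : (1 < 4)%N)) p1.
  have := card_units_Zp (isT : (0 < 4)%N).
  by rewrite (eqP gen_u) u1 cycle1 cards1.
by case: (p %% 4)%N (ltn_pmod p (isT : (0 < 4)%N)) => [|[|[|[]]]].
Qed.

Section AbsoluteTrace.

Context {F : finFieldType} {p : nat} (charFp : p \in [pchar F]).
Local Notation L := (pPrimeCharType charFp).
Local Notation Tr := (absolute_trace charFp).

Let natr_Fp (u : 'F_p) : (u : nat)%:R = u%:A :> L.
Proof. by rewrite [RHS]mulr1. Qed.

(** The prime field embeds in F, so identities about the trace can be checked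
in F, where it is the Galois trace. *)
Lemma absolute_trace_unique x (u : 'F_p) :
  (u : nat)%:R = galois_trace charFp x -> Tr x = u.
Proof.
rewrite -absolute_traceP => Du.
by apply: (fmorph_inj (in_alg L)); rewrite /= -!natr_Fp.
Qed.

Fact absolute_trace_is_zmod_morphism : zmod_morphism Tr.
Proof.
move=> x y; apply: absolute_trace_unique.
have -> : galois_trace charFp (x - y)
    = galois_trace charFp x - galois_trace charFp y.
  exact: (raddfB (galTrace 1%AS {:L}%AS)).
by rewrite -!absolute_traceP natr_Fp scalerBl -!natr_Fp.
Qed.

HB.instance Definition _ :=
  GRing.isZmodMorphism.Build F 'F_p Tr absolute_trace_is_zmod_morphism.

(** The Frobenius map belongs to the Galois group, and translating by an
element of the group permutes the terms of the trace. *)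
Lemma absolute_trace_Frobenius x : Tr (x ^+ p) = Tr x.
Proof.
have [alpha gen_alpha Dalpha] :=
  @finField_galois_generator _ L 1%AS {:L}%AS (sub1v _).
apply: absolute_trace_unique; rewrite absolute_traceP /galois_trace.
have -> : x ^+ p = alpha x :> L.
  by rewrite Dalpha ?memvf // dimv1 expn1 card_Fp // (pcharf_prime charFp).
by rewrite galTrace_gal ?memvf // (eqP gen_alpha) cycle_id.
Qed.

(** Each automorphism contributes 1, and there are as many of them as the
degree of F over its prime field. *)
Lemma absolute_trace1 n : #|F| = (p ^ n)%N -> Tr 1 = n%:R.
Proof.
move=> cardF; have pr_p := pcharf_prime charFp.
apply: absolute_trace_unique.
have -> : galois_trace charFp 1 = n%:R :> L.
  have galL : galois 1 {:L} by apply: finField_galois (sub1v _).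
  rewrite /galois_trace /galTrace.
  under eq_bigr do rewrite rmorph1.
  rewrite sumr_const -galois_dim // dimv1 divn1 pprimeChar_dimf cardF.
  by rewrite pfactorK.
by rewrite natr_Fp scaler_nat.
Qed.

End AbsoluteTrace.

Section AdditiveCharacter.

Variable R : realType.

Lemma expiD (s t : R) : expi (s + t) = expi s * expi t.
Proof. by rewrite /expi cosD sinD [sin s * _ + _]addrC. Qed.

Lemma expiMn (t : R) n : expi (t *+ n) = expi t ^+ n.
Proof.
elim: n => [|n IHn]; first by rewrite mulr0n /expi cos0 sin0.
by rewrite mulrS expiD IHn exprS.
Qed.

Lemma additive_charE (F : finFieldType) p (charFp : p \in [pchar F]) x :
  additive_char R charFp x = zeta R (absolute_trace charFp x).
Proof. by rewrite /additive_char /zeta -expiMn mulrAC mulr_natr. Qed.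

End AdditiveCharacter.

Theorem theorem2p2 (R : realType) (p : nat) (F : finFieldType)
    (p_prime : prime p) (p_odd : odd p) (p_root : primitive_root_mod 4 p)
    (cardF : #|F| = (p ^ 2)%N)
    (g : {unit F}) (g_prim : generator [set: {unit F}] g)
    (xi : F) (xi_def : xi = val g ^+ ((p ^ 2 - 1) %/ 4))
    (a : F) (a1 a2 : 'F_p)
    (a_def : a = (a1 : nat)%:R * xi + (a2 : nat)%:R * xi ^+ 2) :
  char_sum4 R (card_finPcharP cardF p_prime) xi a =
    zeta R (2%:R * a1) + zeta R (- (2%:R * a1))
    + zeta R (2%:R * a2) + zeta R (- (2%:R * a2)).
Proof.
set charFp := card_finPcharP cardF p_prime.
have p3 := primitive_root_mod4 _ p_root.
have order_g : #[g]%g = (p ^ 2 - 1)%N.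
  by rewrite orderE -(eqP g_prim) card_finField_unit cardF subn1.
have Dm : ((p ^ 2 - 1) %/ 4 * 4 = p ^ 2 - 1)%N.
  apply/divnK; rewrite -(eqn_mod_dvd _) ?expn_gt0 ?prime_gt0 //.
  by rewrite -modnXm p3.
have m_gt0 : (0 < (p ^ 2 - 1) %/ 4)%N.
  rewrite -(ltn_pmul2r (isT : (0 < 4)%N)) Dm subn_gt0.
  by rewrite (ltn_exp2l 0) ?prime_gt1.
set m := ((p ^ 2 - 1) %/ 4)%N in xi_def Dm m_gt0.
(* xi ^+ 2 is a square root of 1, and it is not 1 because 2 * m is smaller
   than the order 4 * m of g. *)
have xi2 : xi ^+ 2 = -1.
  have : (xi ^+ 2) ^+ 2 == 1.
    by rewrite -exprM xi_def -exprM Dm -order_g -FinRing.val_unitX expg_order.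
  rewrite sqrf_eq1 => /orP[|/eqP //].
  rewrite xi_def -exprM -FinRing.val_unitX => /eqP g1.
  have /eqP : (g ^+ (m * 2) = 1)%g by apply: val_inj.
  rewrite -order_dvdn order_g -Dm => /dvdn_leq.
  by rewrite muln_gt0 m_gt0 leq_pmul2l // => /(_ isT).
have xip : xi ^+ p = - xi.
  rewrite (divn_eq p 4) p3 exprD mulnC exprM (exprM xi 2 2) xi2 sqrrN !expr1n.
  by rewrite mul1r exprS xi2 mulrN1.
have Tr1 : absolute_trace charFp 1 = 2%:R by apply: absolute_trace1.
have Tr_xi : absolute_trace charFp xi = 0.
  have /eqP := absolute_trace_Frobenius charFp xi.
  rewrite xip raddfN eq_sym -addr_eq0 -mulr2n -mulr_natl mulf_eq0.
  case/orP=> [|/eqP //]; rewrite -(dvdn_pcharf (pchar_Fp p_prime)).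
  by rewrite dvdn_prime2 // => /eqP p2; rewrite p2 in p_odd.
have Da : a = xi *+ a1 - 1 *+ a2 by rewrite a_def xi2 mulrN1 mulr_natl.
have Daxi : a * xi = - (1 *+ a1 + xi *+ a2).
  by rewrite Da mulrBl !mulrnAl mul1r -expr2 xi2 mulNrn opprD.
have Tra : absolute_trace charFp a = - (2%:R * a2).
  rewrite Da raddfB !raddfMn /= Tr_xi Tr1 mul0rn add0r.
  by rewrite -(mulr_natr _ a2) natr_Zp mulNr.
have Traxi : absolute_trace charFp (a * xi) = - (2%:R * a1).
  rewrite Daxi raddfN raddfD !raddfMn /= Tr_xi Tr1 mul0rn addr0.
  by rewrite -(mulr_natr _ a1) natr_Zp.
(* The last two terms are those at - a and - (a * xi). *)
rewrite /char_sum4 !big_ord_recl big_ord0 addr0 !additive_charE /=.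
rewrite /bump /= expr0 mulr1 expr1 !addn0 xi2 mulrN1 exprS xi2 mulrN1 mulrN.
rewrite !raddfN /= Tra Traxi !opprK.
by rewrite [RHS]addrC; congr (_ + _); rewrite addrA addrC addrA.
Qed.
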